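(* Let $G$ be a finite Abelian group, $D\ge 2$, $1\le j<D$, and let $$a_i=e+\sum_{\mu=1}^{r_i}g_{i,\mu}\in\mathbb F_2[G],\qquad i\in[D]=\{1,\ldots,D\},$$ where for each $i$ the elements $e,g_{i,1},\dots,g_{i,r_i}$ of $G$ are distinct. Let $L_D$, $\Phi$, $\Lambda=\ker\Phi$, $\mathcal J_i$ and the neighborhoods $\mathcal N_i^{\pm}$ be as in the context, and let $H\le G$ be the subgroup generated by all the $g_{i,\mu}$. Consider the level-$j$ AMC CSS code with check matrices $$H_X=Q_j^{(D)},\qquad H_Z=\bigl(Q_{j+1}^{(D)}\bigr)^{\mathsf T}$$ obtained from $\mathcal Q^{(D)}=\operatorname{AMC}(a_1,\ldots,a_D)$. Let $\mathcal T$ be the graph whose vertices are, for every $u\in L_D/\Lambda$, the qubits $q_I(u)$ with $I\subseteq[D]$, $|I|=j$; the $X$-checks $X_K(u)$ with $K\subseteq[D]$, $|K|=j-1$; and the $Z$-checks $Z_M(u)$ with $M\subseteq[D]$, $|M|=j+1$; and in which each check is joined exactly to the qubits in the set $$X_K(u):\ \bigcup_{i\in[D]\setminus K}\mathcal N_i^-\bigl(q_{K\cup\{i\}},u\bigr),\qquad Z_M(u):\ \bigcup_{i\in M}\mathcal N_i^+\bigl(q_{M\setminus\{i\}},u\bigr).$$ If $H=G$, then $\mathcal T$ is permutation-isomorphic to the Tanner graph of this AMC code; that is, there are bijections from the qubits of $\mathcal T$ to the common columns of $H_X$ and $H_Z$, from the $X$-checks of $\mathcal T$ to the rows of $H_X$,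 and from the $Z$-checks of $\mathcal T$ to the rows of $H_Z$, under which adjacency corresponds exactly to nonzero matrix entries. If $H<G$ is a proper subgroup, then the Tanner graph of the full code is (up to such a permutation isomorphism) the disjoint union of copies of $\mathcal T$ indexed by the cosets of $H$ in $G$.
   Context: $G$ is a finite Abelian group (written multiplicatively) with identity $e$ and order $\ell=|G|$; $\mathbb F_2[G]$ is its group algebra. For $g\in G$, $\rho(g)$ is the $\ell\times\ell$ left-regular permutation matrix over $\mathbb F_2$ with $[\rho(g)]_{h,k}=1$ if $h=gk$ and $0$ otherwise, extended linearly to $\mathbb F_2[G]$. Put $A_i=\rho(a_i)$; these matrices commute. AMC complex. $\mathcal Q^{(D)}=\operatorname{AMC}(a_1,\ldots,a_D)$ is the chain complex with boundary matrices $Q_i^{(D)}\in\operatorname{Mat}_{\binom{D}{i-1}\ell\times\binom{D}{i}\ell}(\mathbb F_2)$, $1\le i\le D$, defined recursively by $$Q_1^{(2)}=\begin{bmatrix} A_2 & A_1 \end{bmatrix},\qquad Q_2^{(2)}=\begin{bmatrix} A_1 \\ A_2 \end{bmatrix},$$ and, for $D\ge2$, $$Q_1^{(D+1)}=\begin{bmatrix} A_{D+1} & Q_1^{(D)} \end{bmatrix},\qquad Q_{D+1}^{(D+1)}=\begin{bmatrix} Q_D^{(D)} \\ A_{D+1} \end{bmatrix},$$ $$Q_i^{(D+1)}=\begin{bmatrix} Q_{i-1}^{(D)} & 0 \\ I_{\binom{D}{i-1}}\otimes A_{D+1} & Q_i^{(D)} \end{bmatrix}\quad(2\le i\le D).$$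 They satisfy $Q_i^{(D)}Q_{i+1}^{(D)}=0$. The level-$j$ code has $\binom Dj\ell$ qubits, which index the columns of both $H_X=Q_j^{(D)}$ and $H_Z=(Q_{j+1}^{(D)})^{\mathsf T}$. Its Tanner graph has one vertex per qubit, one $X$-check vertex per row of $H_X$, one $Z$-check vertex per row of $H_Z$, and an edge between a check and a qubit for each nonzero entry. Quotient lattice. For each $i\in[D]$ and $\mu\in\{1,\dots,r_i\}$ introduce a formal basis vector $\mathbf j_{i,\mu}$ (kept distinct for different $i$ even if the group elements coincide). Set $$\mathcal J_i=\{\mathbf j_{i,1},\ldots,\mathbf j_{i,r_i}\},\qquad L_D=\bigoplus_{i=1}^D\bigoplus_{\mu=1}^{r_i}\mathbb Z\,\mathbf j_{i,\mu},$$ let $\Phi:L_D\to G$ be the group homomorphism with $\Phi(\mathbf j_{i,\mu})=g_{i,\mu}$, and let $\Lambda=\ker\Phi$; thus $L_D/\Lambda\simeq H=\operatorname{im}\Phi$. Neighborhoods. For a qubit type $q$ (with qubits $q(u)$, $u\in L_D/\Lambda$), $$\mathcal N_i^-(q,u)=\{q(u)\}\cup\{q(u-\mathbf j):\mathbf j\in\mathcal J_i\},\qquad \mathcal N_i^+(q,u)=\{q(u)\}\cup\{q(u+\mathbf j):\mathbf j\in\mathcal J_i\},$$ with $u\pm\mathbf j$ taken in $L_D/\Lambda$. *)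

(* Defs.v *)
(* G is a finZmodType, i.e. the finite abelian group is written
   additively: the identity e is 0 and the product g k is g + k. *)
From HB Require Import structures.
From mathcomp Require Import all_boot all_order all_algebra all_fingroup.
From mathcomp Require Import mxtens.
Set Implicit Arguments.
Unset Strict Implicit.
Unset Printing Implicit Defensive.
Import GRing.Theory.
Local Open Scope ring_scope.

(* The underlying F_2-space of the group algebra F_2[G]; only its linear
   structure is used. *)
Definition group_alg (G : finZmodType) := {ffun G -> 'F_2}.

Definition ga_of (G : finZmodType) (g : G) : group_alg G :=
  [ffun h => (h == g)%:R].

Definition rho_elt (G : finZmodType) (g : G) : 'M['F_2]_#|G| :=
  \matrix_(h, k) (enum_val h == g + enum_val k)%:R.

Definition rho (G : finZmodType) (a : group_alg G) : 'M['F_2]_#|G| :=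
  \sum_g a g *: rho_elt g.

(* The boundary matrices of AMC(a_1, ..., a_D) as functions of the family
   A_i = rho a_i. The index set [D] is 'I_D, so A_(i+1) is A i; the boundary
   index i is not shifted: it ranges over 1 <= i <= D (the values at i = 0 and
   at i > D are irrelevant). The casts are the identities
   'C(D + 1, i) = 'C(D, i - 1) + 'C(D, i). *)
Definition amc_type (l D : nat) :=
  ('I_D -> 'M['F_2]_l) -> forall i : nat, 'M['F_2]_('C(D, i.-1) * l, 'C(D, i) * l).

Lemma amc_dim1 n l : (l = 'C(n, 0) * l)%N.
Proof. by rewrite bin0 mul1n. Qed.

Lemma amc_dimn n l : (l = 'C(n, n) * l)%N.
Proof. by rewrite binn mul1n. Qed.

Lemma amc_dim21 l : (l + l = 'C(2, 1) * l)%N.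
Proof. by rewrite bin1 mul2n addnn. Qed.

Lemma amc_dimS n k l : ('C(n, k) * l + 'C(n, k.+1) * l = 'C(n.+1, k.+1) * l)%N.
Proof. by rewrite binS mulnDl addnC. Qed.

Lemma amc_dim_row1 n l : (l + 'C(n, 1) * l = 'C(n.+1, 1) * l)%N.
Proof. by rewrite !bin1 mulSn. Qed.

Lemma amc_dim_toprow d k l : k.+2 = d.+3 ->
  ('C(d.+2, d.+1) * l + l = 'C(d.+3, k.+1) * l)%N.
Proof. by case=> ->; rewrite !binSn mulSn addnC. Qed.

Lemma amc_dim_topcol d k l : k.+2 = d.+3 ->
  ('C(d.+2, d.+2) * l = 'C(d.+3, k.+2) * l)%N.
Proof. by case=> ->; rewrite !binn. Qed.

Definition amc2 l : amc_type l 2 := fun A i =>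
  match i with
  | 1 => castmx (amc_dim1 2 l, amc_dim21 l) (row_mx (A ord_max) (A ord0))
  | 2 => castmx (amc_dim21 l, amc_dimn 2 l) (col_mx (A ord0) (A ord_max))
  | _ => 0
  end.

Definition amc_succ l d (Q : amc_type l d.+2) : amc_type l d.+3 := fun A i =>
  let A' := fun m : 'I_d.+2 => A (widen_ord (leqnSn d.+2) m) in
  let An := A ord_max in
  match i with
  | 0 => 0
  | 1 => castmx (amc_dim1 d.+3 l, amc_dim_row1 d.+2 l)
           (row_mx An (castmx (esym (amc_dim1 d.+2 l), erefl) (Q A' 1%N)))
  | k.+2 =>
    match @eqP _ k.+2 d.+3 with
    | ReflectT e => castmx (amc_dim_toprow l e, amc_dim_topcol l e)
        (col_mx (Q A' d.+2) (castmx (erefl, amc_dimn d.+2 l) An))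
    | ReflectF _ => castmx (amc_dimS d.+2 k l, amc_dimS d.+2 k.+1 l)
        (block_mx (Q A' k.+1) 0
                  ((1%:M : 'M_('C(d.+2, k.+1))) *t An) (Q A' k.+2))
    end
  end.

(* The recursion starts at D = 2; D = 0, 1 get dummy values. *)
Fixpoint amc_mx l (D : nat) : amc_type l D :=
  match D return amc_type l D with
  | 0 => fun _ _ => 0
  | D'.+1 =>
    match D' return amc_type l D' -> amc_type l D'.+1 with
    | 0 => fun _ _ _ => 0
    | 1 => fun _ => @amc2 l
    | d.+2 => @amc_succ l d
    end (@amc_mx l D')
  end.

Definition AMC (G : finZmodType) D (a : 'I_D -> group_alg G) (i : nat) :
    'M['F_2]_('C(D, i.-1) * #|G|, 'C(D, i) * #|G|) :=
  amc_mx (fun m => rho (a m)) i.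

Record tanner_graph := TannerGraph {
  qubit : Type;
  xcheck : Type;
  zcheck : Type;
  xadj : xcheck -> qubit -> bool;
  zadj : zcheck -> qubit -> bool
}.

Definition tanner_of_css m n p (HX : 'M['F_2]_(m, n)) (HZ : 'M['F_2]_(p, n)) :=
  TannerGraph (fun (s : 'I_m) (q : 'I_n) => HX s q != 0)
              (fun (s : 'I_p) (q : 'I_n) => HZ s q != 0).

Definition perm_isomorphic (T1 T2 : tanner_graph) : Prop :=
  exists (fq : qubit T1 -> qubit T2) (fx : xcheck T1 -> xcheck T2)
         (fz : zcheck T1 -> zcheck T2),
    [/\ bijective fq, bijective fx, bijective fz,
        forall s q, xadj (fx s) (fq q) = xadj s q
      & forall s q, zadj (fz s) (fq q) = zadj s q].

Definition disjoint_copies (C : eqType) (T : tanner_graph) :=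
  TannerGraph
    (fun (s : C * xcheck T) (q : C * qubit T) => (s.1 == q.1) && xadj s.2 q.2)
    (fun (s : C * zcheck T) (q : C * qubit T) => (s.1 == q.1) && zadj s.2 q.2).

Definition gen_index D (r : 'I_D -> nat) := {i : 'I_D & 'I_(r i)}.

Definition gen_family D (r : 'I_D -> nat) (G : finZmodType)
    (g : forall i, 'I_(r i) -> G) (p : gen_index r) : G := g (tag p) (tagged p).

Definition amc_elt D (r : 'I_D -> nat) (G : finZmodType)
    (g : forall i, 'I_(r i) -> G) (i : 'I_D) : group_alg G :=
  ga_of 0 + \sum_(mu < r i) ga_of (g i mu).

Definition lattice D (r : 'I_D -> nat) := {ffun gen_index r -> int}.

Definition jvec D (r : 'I_D -> nat) (i : 'I_D) (mu : 'I_(r i)) : lattice r :=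
  [ffun p => (p == Tagged (fun i => 'I_(r i)) mu)%:Z].

Definition Phi D (r : 'I_D -> nat) (G : finZmodType)
    (g : forall i, 'I_(r i) -> G) (x : lattice r) : G :=
  \sum_p gen_family g p *~ x p.

Lemma Phi_zmod_morphism D (r : 'I_D -> nat) (G : finZmodType)
  (g : forall i, 'I_(r i) -> G) : zmod_morphism (Phi g).
Proof.
move=> x y; rewrite /Phi -sumrB; apply: eq_bigr => p _.
by rewrite !ffunE mulrzBr.
Qed.

HB.instance Definition _ D (r : 'I_D -> nat) (G : finZmodType)
    (g : forall i, 'I_(r i) -> G) :=
  GRing.isZmodMorphism.Build (lattice r) G (Phi g) (Phi_zmod_morphism g).

Lemma Phi_jvec D (r : 'I_D -> nat) (G : finZmodType)
  (g : forall i, 'I_(r i) -> G) i mu : Phi g (jvec mu) = g i mu.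
Proof.
rewrite /Phi (bigD1 (Tagged (fun i => 'I_(r i)) mu)) //= ffunE eqxx mulr1z.
by rewrite big1 ?addr0 // => p /negPf np; rewrite ffunE np mulr0z.
Qed.

Definition Lambda D (r : 'I_D -> nat) (G : finZmodType)
    (g : forall i, 'I_(r i) -> G) : {pred lattice r} :=
  fun x => Phi g x == 0.

Lemma Lambda_zmod_closed D (r : 'I_D -> nat) (G : finZmodType)
  (g : forall i, 'I_(r i) -> G) : zmod_closed (Lambda g).
Proof.
split=> [|x y]; rewrite !unfold_in /Lambda; first by rewrite raddf0.
by rewrite Phi_zmod_morphism => /eqP-> /eqP->; rewrite subrr.
Qed.

HB.instance Definition _ D (r : 'I_D -> nat) (G : finZmodType)
    (g : forall i, 'I_(r i) -> G) :=
  GRing.isZmodClosed.Build (lattice r) (Lambda g) (Lambda_zmod_closed g).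

Definition quot_lattice D (r : 'I_D -> nat) (G : finZmodType)
    (g : forall i, 'I_(r i) -> G) := Quotient.quot (Lambda g).

Definition jclass D (r : 'I_D -> nat) (G : finZmodType)
    (g : forall i, 'I_(r i) -> G) (i : 'I_D) (mu : 'I_(r i)) : quot_lattice g :=
  \pi_(quot_lattice g)%qT (jvec mu).

(* The pair (I, u) encodes the vertex of type I at position u. *)
Definition site D (r : 'I_D -> nat) (G : finZmodType)
    (g : forall i, 'I_(r i) -> G) := ({set 'I_D} * quot_lattice g)%type.

Definition nbhd_minus D (r : 'I_D -> nat) (G : finZmodType)
    (g : forall i, 'I_(r i) -> G) (i : 'I_D) (q : {set 'I_D})
    (u : quot_lattice g) : seq (site g) :=
  (q, u) :: [seq (q, u - jclass g mu) | mu : 'I_(r i)].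

Definition nbhd_plus D (r : 'I_D -> nat) (G : finZmodType)
    (g : forall i, 'I_(r i) -> G) (i : 'I_D) (q : {set 'I_D})
    (u : quot_lattice g) : seq (site g) :=
  (q, u) :: [seq (q, u + jclass g mu) | mu : 'I_(r i)].

Definition vertex D (r : 'I_D -> nat) (G : finZmodType)
    (g : forall i, 'I_(r i) -> G) (k : nat) := {v : site g | #|v.1| == k}.

Definition lattice_tanner D (r : 'I_D -> nat) (G : finZmodType)
    (g : forall i, 'I_(r i) -> G) (j : nat) : tanner_graph :=
  TannerGraph
    (fun (s : vertex g j.-1) (q : vertex g j) =>
       let: (K, u) := val s in
       [exists i in ~: K, val q \in nbhd_minus i (i |: K) u])
    (fun (s : vertex g j.+1) (q : vertex g j) =>
       let: (M, u) := val s in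
       [exists i in M, val q \in nbhd_plus i (M :\ i) u]).

Definition gen_subgroup D (r : 'I_D -> nat) (G : finZmodType)
    (g : forall i, 'I_(r i) -> G) : {group G} :=
  <<[set gen_family g p | p : gen_index r]>>%G.

Definition coset_index (G : finZmodType) (H : {group G}) :=
  {C : {set G} | C \in rcosets H [set: G]}.

(* Main.v *)
(* Unrolling the recursion, the blocks of Q_i^(D) are indexed by subsets of [D]:
   the block in row K (|K| = i - 1) and column I (|I| = i) is A_m if
   I = K U {m} with m not in K, and 0 otherwise. Row (K, h) and column (I, k)
   are therefore adjacent iff h - k is in the support of a_m, that is, h = k or
   h = k + g_{m,mu} for some mu. On the other side Phi identifies L_D / Lambda
   with H, and adding coset representatives identifies the pairs (coset, u) with
   the elements of G. Adjacent positions differ by an element of H, so they lie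
   in the same coset. *)

Require Import Defs.
From HB Require Import structures.
From mathcomp Require Import all_boot all_order all_algebra all_fingroup.
From mathcomp Require Import mxtens zify.
Set Implicit Arguments.
Unset Strict Implicit.
Unset Printing Implicit Defensive.
Import GRing.Theory.
Local Open Scope ring_scope.

(* generic_quotient.repr is hidden by the coset representative fingroup.repr. *)
Local Notation quot_repr := generic_quotient.repr.

(** * Subsets of the index set and their block positions *)

Definition restrict n (I : {set 'I_n.+1}) : {set 'I_n} :=
  [set m | widen_ord (leqnSn n) m \in I].

(* Position of the block I among the 'C(n, #|I|) blocks of that size, in the
   order produced by the AMC recursion: the sets containing the last index come
   first. The offset is 'C(n', #|I| - 1) unless I is empty, when it is 0. *)
Fixpoint rank n : {set 'I_n} -> nat :=
  match n with
  | 0 => fun _ => 0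
  | n'.+1 => fun I =>
    let I' := restrict I in
    (if ord_max \in I then 0 else 'C(n'.+1, #|I'|) - 'C(n', #|I'|)) + rank I'
  end%N.

Lemma in_restrict n (I : {set 'I_n.+1}) m :
  (m \in restrict I) = (widen_ord (leqnSn n) m \in I).
Proof. exact: in_set. Qed.

Lemma in_setS n (I : {set 'I_n.+1}) i :
  (i \in I) = if unlift ord_max i is Some m then m \in restrict I
              else ord_max \in I.
Proof.
case: unliftP => [m|] -> //.
rewrite inE; suff -> : lift ord_max m = widen_ord (leqnSn n) m by [].
exact/val_inj/lift_max.
Qed.

Lemma eq_setS n (I J : {set 'I_n.+1}) :
  (I == J) = ((ord_max \in I) == (ord_max \in J)) && (restrict I == restrict J).
Proof.
apply/eqP/andP => [-> //|[/eqP e1 /eqP e2]].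
by apply/setP => i; rewrite [LHS]in_setS [RHS]in_setS e1 e2.
Qed.

Lemma card_setS n (I : {set 'I_n.+1}) :
  #|I| = (if ord_max \in I then #|restrict I|.+1 else #|restrict I|).
Proof.
rewrite -!sum1_card big_mkcond big_ord_recr /= [LHS]addnC [in RHS]big_mkcond /=.
under eq_bigr => i _ do rewrite -in_restrict.
by case: (ord_max \in I).
Qed.

(** By Pascal's rule the truncated difference in [rank] equals ['C(n, k)], the number of sets of
    size [k.+1] that contain the last index and are listed first. *)
Lemma rankS n (I : {set 'I_n.+1}) k : #|I| = k.+1 ->
  rank I = (if ord_max \in I then rank (restrict I)
            else 'C(n, k) + rank (restrict I))%N.
Proof.
rewrite card_setS /=; case: (ord_max \in I) => // [->].
by rewrite binS addKn.
Qed.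

Lemma rank_lt n (I : {set 'I_n}) : (rank I < 'C(n, #|I|))%N.
Proof.
elim: n I => [|n IHn] I.
  by rewrite (_ : I = set0) ?cards0 //; apply/setP; case.
move: (IHn (restrict I)).
case: #|I| (card_setS I) (@rankS n I) => [|k] cI rI.
  move: cI => /=; case: (ord_max \in I) => //= <-; rewrite !bin0 subnn add0n.
  by [].
rewrite (rI k) // binS; move: cI; case: (ord_max \in I) => /= [[<-]|<-]; lia.
Qed.

(** By [rank_lt], sets containing the last index fill an initial range of positions and the others
    come after it. Equal ranks thus force agreement at that index, and induction treats the
    restrictions. *)
Lemma rank_inj n (I J : {set 'I_n}) : #|I| = #|J| -> rank I = rank J -> I = J.
Proof.
elim: n I J => [|n IHn] I J; first by move=> _ _; apply/setP; case.
move=> cIJ rIJ; apply/eqP; rewrite eq_setS.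
move: cIJ rIJ (rank_lt (restrict I)) (rank_lt (restrict J)).
case: #|J| (card_setS J) (@rankS n J) => [|k] cJ rJ cI.
  move: (card_setS I); rewrite cI /=; move: cJ.
  case: (ord_max \in J) => //= cJ; case: (ord_max \in I) => //= cI'.
  rewrite -cI' -cJ.
  by rewrite !bin0 !subnn !add0n => rIJ _ _; apply/eqP/IHn; rewrite -?cJ -?cI'.
rewrite (rJ k) // (rankS cI); move: cJ (card_setS I); rewrite cI.
case: (ord_max \in J) => /= [[cJ]|cJ]; case: (ord_max \in I) => /= [[cI']|cI'];
  rewrite -?cI' -?cJ => rIJ lI lJ; try (exfalso; move: rIJ lI lJ; lia);
  apply/eqP/IHn; rewrite -?cI' -?cJ //.
by apply: (addnI rIJ).
Qed.

(** * Entries of the boundary matrices *)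

Definition boundary_entry l n (A : 'I_n -> 'M['F_2]_l) (K I : {set 'I_n}) h k :=
  \sum_(m | (m \notin K) && (I == m |: K)) A m h k.

Lemma restrictU1 n (K : {set 'I_n.+1}) m :
  restrict (widen_ord (leqnSn n) m |: K) = m |: restrict K.
Proof. by apply/setP=> i; rewrite !inE. Qed.

Lemma restrictU1_max n (K : {set 'I_n.+1}) :
  restrict (ord_max |: K) = restrict K.
Proof.
apply/setP=> i; rewrite !inE (_ : widen_ord _ _ == _ = false) //.
by apply/eqP => /(congr1 val) /= e; have := ltn_ord i; rewrite e ltnn.
Qed.

(** The cases are the four blocks of the recursion: adding an index below [ord_max] preserves
    membership of [ord_max], while adding [ord_max] to [K] changes it and keeps the restriction. *)
Lemma boundary_entryS l n (A : 'I_n.+1 -> 'M['F_2]_l) (K I : {set 'I_n.+1})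
    h k :
  boundary_entry A K I h k =
  if (ord_max \in K) == (ord_max \in I) then
    boundary_entry (fun m => A (widen_ord (leqnSn n) m))
      (restrict K) (restrict I) h k
  else if ord_max \in I then
    (restrict K == restrict I)%:R * A ord_max h k
  else 0.
Proof.
have ltW (m : 'I_n) : ord_max == widen_ord (leqnSn n) m = false.
  by apply/eqP => /(congr1 val) /= e; have := ltn_ord m; rewrite -e ltnn.
rewrite /boundary_entry big_mkcond big_ord_recr /= eq_setS restrictU1_max.
rewrite !inE eqxx /=.
rewrite (eq_bigr (fun m => if (ord_max \in K) == (ord_max \in I) then
  if (m \notin restrict K) && (restrict I == m |: restrict K)
  then A (widen_ord (leqnSn n) m) h k else 0 else 0)); last first.
  move=> m _; rewrite eq_setS restrictU1 !inE ltW /=.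
  by case: (ord_max \in K); case: (ord_max \in I); rewrite //= ?andbF.
case: (ord_max \in K); case: (ord_max \in I) => /=.
- by rewrite addr0 -big_mkcond.
- by rewrite addr0 big1.
- rewrite big1 // add0r eq_sym.
  by case: eqP => _; rewrite ?mul1r ?mul0r.
- by rewrite addr0 -big_mkcond.
Qed.

Lemma rank_lt_card n k (I : {set 'I_n}) : #|I| = k -> (rank I < 'C(n, k))%N.
Proof. by move<-; apply: rank_lt. Qed.

Lemma ltn_mulD a m l (h : 'I_l) : (a < m -> a * l + h < m * l)%N.
Proof. by move=> am; have := mxtens_index_proof (Ordinal am, h). Qed.

Lemma tens1mxE l m (A : 'M['F_2]_l) a b (h k : 'I_l) (r c : 'I_(m * l)) :
    (a < m)%N -> (b < m)%N -> r = (a * l + h)%N :> nat ->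
    c = (b * l + k)%N :> nat ->
  ((1%:M : 'M_m) *t A) r c = (a == b)%:R * A h k.
Proof.
move=> am bm Er Ec.
have -> : r = mxtens_index (Ordinal am, h) by apply: val_inj.
have -> : c = mxtens_index (Ordinal bm, k) by apply: val_inj.
by rewrite tensmxE mxE.
Qed.

Lemma rank0 n : rank (set0 : {set 'I_n}) = 0%N.
Proof.
by have := rank_lt_card (cards0 'I_n); rewrite bin0 ltnS leqn0 => /eqP.
Qed.

Lemma rank_full n (I : {set 'I_n}) : #|I| = n -> rank I = 0%N.
Proof. by move/rank_lt_card; rewrite binn ltnS leqn0 => /eqP. Qed.

Lemma restrict0 n : restrict (set0 : {set 'I_n.+1}) = set0.
Proof. by apply/setP => i; rewrite !inE. Qed.

Arguments rank : simpl never.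
Arguments amc_mx : simpl never.

Lemma amc_mxS l d : @amc_mx l d.+3 = amc_succ (@amc_mx l d.+2).
Proof. by []. Qed.

Lemma rank_eq n (I J : {set 'I_n}) :
  #|I| = #|J| -> (rank I == rank J) = (I == J).
Proof. by move=> cIJ; apply/eqP/eqP => [/(rank_inj cIJ)|->]. Qed.

Lemma set_full n (I : {set 'I_n}) : #|I| = n -> I = setT.
Proof.
by move=> cI; apply/eqP; rewrite eqEcard subsetT cardsT card_ord cI leqnn.
Qed.

(** Serves the base D = 2, where removing the last of two indices leaves a single one. *)
Lemma boundary_entry1 l (A : 'I_1 -> 'M['F_2]_l) (K I : {set 'I_1}) h k :
  #|K| = 0%N -> #|I| = 1%N -> boundary_entry A K I h k = A ord0 h k.
Proof.
move=> /cards0_eq -> /set_full ->.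
rewrite /boundary_entry big_mkcond big_ord1 inE setU0 /=.
by rewrite ifT //; apply/eqP/esym/set_full; rewrite cards1.
Qed.

(** [rank] lists sets containing the last index first, just as the recursion stacks its blocks, so
    membership of [ord_max] decides the block. Flat indices are given by equations between naturals,
    which survive casts and splits and let the induction hypothesis apply. *)
Lemma amc_mxE l n (A : 'I_n.+2 -> 'M['F_2]_l) k (K I : {set 'I_n.+2})
    (h h' : 'I_l)
    (r : 'I_('C(n.+2, k.+1.-1) * l)) (c : 'I_('C(n.+2, k.+1) * l)) :
    #|K| = k -> #|I| = k.+1 ->
    r = (rank K * l + h)%N :> nat -> c = (rank I * l + h')%N :> nat ->
  amc_mx A k.+1 r c = boundary_entry A K I h h'.
Proof.
elim: n A k K I r c => [|n IHn] A k K I r c cK cI Er Ec.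
  have lh := ltn_ord h; have lh' := ltn_ord h'.
  rewrite -[amc_mx A]/(amc2 A) boundary_entryS.
  have cI' := card_setS I; rewrite cI in cI'.
  move: Ec; rewrite (rankS cI) => Ec.
  have A0 : A ord0 = A (widen_ord (leqnSn 1) ord0) by congr A; apply: val_inj.
  (* For D = 2, [K] is empty when [k = 0], [I] is full when [k = 1], and larger [k] exceeds the
     possible cardinality of [I]. *)
  case: k => [|[|k]] in r c cK cI Er Ec cI' *.
  - have K0 : K = set0 by apply: cards0_eq.
    subst K; rewrite rank0 mul0n add0n in Er; rewrite inE restrict0.
    rewrite castmxE mxE.
    case: (ord_max \in I) cI' Ec => /= [[cI']|[cI']] Ec;
    case: splitP => c' /= Ec'.
    + have I0 := cards0_eq (esym cI'); rewrite I0 rank0 mul0n add0n in Ec.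
      rewrite I0 eqxx mul1r; congr (A _ _ _); apply: val_inj => //=.
      by rewrite -Ec'.
    + by exfalso; move: Ec; rewrite (cards0_eq (esym cI')) rank0; lia.
    + by exfalso; have := ltn_ord c'; rewrite bin0 in Ec; lia.
    + rewrite bin0 (rank_full (esym cI')) in Ec.
      rewrite boundary_entry1 ?cards0 // A0.
      congr (A _ _ _); apply: val_inj => //=.
      by lia.
  - have maxI : ord_max \in I.
      case: (_ \in I) cI' => // cI'.
      by have := max_card (mem (restrict I)); rewrite -cI' card_ord ltnn.
    rewrite maxI in cI' Ec *; case: cI' => cI'.
    rewrite (rank_full (esym cI')) mul0n add0n in Ec.
    have cK' := card_setS K; rewrite cK in cK'.
    move: Er; rewrite (rankS cK) => Er.
    rewrite castmxE mxE.
    case: (ord_max \in K) cK' Er => /= [[cK']|cK'] Er;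
    case: splitP => r' /= Er'.
    + have K0 := cards0_eq (esym cK'); rewrite K0 rank0 mul0n add0n in Er.
      rewrite boundary_entry1 // A0; congr (A _ _ _); apply: val_inj => //=.
      by rewrite -Er'.
    + by exfalso; move: Er; rewrite (cards0_eq (esym cK')) rank0; lia.
    + by exfalso; have := ltn_ord r'; rewrite bin0 in Er; lia.
    + rewrite bin0 (rank_full (esym cK')) in Er.
      rewrite (set_full (esym cK')) (set_full (esym cI')) eqxx mul1r.
      by congr (A _ _ _); apply: val_inj => //=; lia.
  - by have := max_card (mem I); rewrite cI card_ord.
rewrite amc_mxS boundary_entryS.
have lh := ltn_ord h; have lh' := ltn_ord h'.
have cI' := card_setS I; rewrite cI in cI'.
move: Ec; rewrite (rankS cI) => Ec.
(* Lowest boundary: [K] is empty and only the columns split. *)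
case: k => [|k] in r c cK cI Er Ec cI' *.
  have K0 : K = set0 by apply: cards0_eq.
  subst K; rewrite rank0 mul0n add0n in Er; rewrite inE restrict0.
  rewrite castmxE mxE.
  case: (ord_max \in I) cI' Ec => /= [[cI']|[cI']] Ec;
    case: splitP => c' /= Ec'.
  - have I0 := cards0_eq (esym cI'); rewrite I0 rank0 mul0n add0n in Ec.
    rewrite I0 eqxx mul1r; congr (A _ _ _); apply: val_inj => //=.
    by rewrite -Ec'.
  - by exfalso; move: Ec; rewrite (cards0_eq (esym cI')) rank0; lia.
  - by exfalso; have := ltn_ord c'; rewrite bin0 in Ec; lia.
  - rewrite bin0 in Ec; rewrite castmxE; apply: IHn; rewrite ?cards0 ?rank0 //=.
    lia.
have cK' := card_setS K; rewrite cK in cK'.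
move: Er; rewrite (rankS cK) => Er.
(* In the equality branch, the top boundary, [I] is the full set and only the rows split. *)
rewrite /amc_succ; case: eqP => [e|ne].
  have ek : k = n.+1 by case: e.
  subst k.
  have maxI : ord_max \in I.
    case: (_ \in I) cI' => // cI'.
    by have := max_card (mem (restrict I)); rewrite -cI' card_ord ltnn.
  rewrite maxI in cI' Ec *; case: cI' => cI'.
  rewrite (rank_full (esym cI')) mul0n add0n in Ec.
  rewrite castmxE mxE.
  case: (ord_max \in K) cK' Er => /= [[cK']|cK'] Er;
    case: splitP => r' /= Er'.
  - by apply: IHn; rewrite ?(rank_full (esym cI')) //=; lia.
  - exfalso; have := ltn_mulD h (rank_lt_card (esym cK')); lia.
  - exfalso; have := ltn_ord r'; rewrite mulnDl in Er; lia.
  - rewrite (_ : restrict K = restrict I); last first.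
      by apply: rank_inj; rewrite -?cK' -?cI' ?rank_full.
    rewrite (rank_full (esym cK')) in Er.
    rewrite castmxE eqxx mul1r; congr (A _ _ _); apply: val_inj => //=.
    by lia.
rewrite castmxE mxE.
case: (ord_max \in K) cK' Er => /= [[cK']|cK'] Er;
case: (ord_max \in I) cI' Ec => /= [[cI']|[cI']] Ec;
case: splitP => r' /= Er'; rewrite mxE; case: splitP => c' /= Ec'.
(* Of the sixteen combinations of membership and block side, the range bounds refute the twelve
   where they disagree; one goal per block remains. *)
all: rewrite Er in Er'; rewrite Ec in Ec'.
all: have := ltn_ord r'; have := ltn_ord c'.
all: have := ltn_mulD h (rank_lt_card (esym cK')).
all: have := ltn_mulD h' (rank_lt_card (esym cI')).
all: rewrite ?(mulnDl 'C(_, _)) in Er' Ec'; try by (move=> *; exfalso; lia).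
- by move=> *; apply: IHn => //=; lia.
- by rewrite mxE.
- move=> _ _ _ _; rewrite -rank_eq -?cK' -?cI' //.
  by apply: tens1mxE; rewrite ?(rank_lt_card (esym cK')) //
    ?(rank_lt_card (esym cI')) //; lia.
- by move=> *; apply: IHn => //=; lia.
Qed.

(** [m] is determined as the element of [I] outside [K], so the sum has at most one term and nothing
    cancels in F_2. *)
Lemma boundary_entry_neq0 l n (A : 'I_n -> 'M['F_2]_l) (K I : {set 'I_n}) h k :
  (boundary_entry A K I h k != 0) =
  [exists m in ~: K, (I == m |: K) && (A m h k != 0)].
Proof.
rewrite /boundary_entry.
case: (pickP [pred m | (m \notin K) && (I == m |: K)]) => /=.
  move=> m /andP[mK /eqP ->]; rewrite (big_pred1 m) => [|m' /=]; last first.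
    apply/andP/eqP => [[m'K /eqP e]|->]; last by rewrite mK.
    by have := setU11 m' K; rewrite -e !inE (negPf m'K) orbF => /eqP.
  apply/idP/exists_inP => [nz|[m']]; first by exists m; rewrite ?inE // eqxx.
  rewrite inE => m'K /andP[/eqP e]; suff -> : m' = m by [].
  by have := setU11 m' K; rewrite -e !inE (negPf m'K) orbF => /eqP.
move=> none; rewrite big_pred0 // eqxx; apply/esym/negbTE.
apply/exists_inP => -[m]; rewrite inE => mK /andP[e _].
by have /= := none m; rewrite mK e.
Qed.

(** Only the group element [h - k] carries column [k] to row [h]. *)
Lemma rhoE (G : finZmodType) (a : group_alg G) h k :
  rho a h k = a (enum_val h - enum_val k).
Proof.
rewrite summxE (bigD1 (enum_val h - enum_val k)) //= !mxE subrK eqxx mulr1.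
rewrite big1 ?addr0 // => x; rewrite !mxE eq_sym subr_eq => /negPf ->.
by rewrite mulr0.
Qed.

(** * The quotient lattice, its image in G, and cosets *)

Section QuotientLattice.
Variables (G : finZmodType) (D : nat) (r : 'I_D -> nat).
Variable g : forall i : 'I_D, 'I_(r i) -> G.
Arguments g : clear implicits.

(** The identity and the [g i mu] are distinct, so no two terms cancel in F_2. *)
Lemma amc_elt_neq0 i x :
    (forall mu, g i mu <> 0) -> injective (g i) ->
  (amc_elt g i x != 0) = (x == 0) || [exists mu, x == g i mu].
Proof.
move=> g0 ginj; rewrite /amc_elt !ffunE sum_ffunE.
under eq_bigr => mu _ do rewrite ffunE.
case: (x =P 0) => [->|_] /=.
  by rewrite big1 ?addr0 // => mu _; case: eqP => // /esym /g0.
rewrite add0r; apply/idP/existsP => [nz|[mu /eqP ->]]; last first.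
  rewrite (bigD1 mu) //= eqxx big1 ?addr0 // => nu nunu.
  by case: eqP => // /ginj e; rewrite e eqxx in nunu.
apply/existsP; apply: contraR nz => /existsPn none.
by rewrite big1 // => mu _; rewrite (negPf (none mu)).
Qed.

(** The embedding of L_D / Lambda into G induced by [Phi], evaluated at a chosen representative;
    [quot_Phi_pi] gives independence of the choice. *)
Definition quot_Phi (u : quot_lattice g) : G := Phi g (quot_repr u).

Lemma quot_Phi_pi x : quot_Phi (\pi_(quot_lattice g)%qT x) = Phi g x.
Proof.
apply/eqP; rewrite /quot_Phi -subr_eq0 -raddfB.
have := Quotient.idealrBE (Lambda g) (quot_repr (\pi_(quot_lattice g)%qT x)) x.
by rewrite reprK eqxx unfold_in.
Qed.

Lemma quot_Phi_inj : injective quot_Phi.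
Proof.
move=> u v e; rewrite -[u]reprK -[v]reprK; apply/eqP.
by rewrite -Quotient.idealrBE unfold_in /Lambda raddfB subr_eq0; apply/eqP.
Qed.

Lemma quot_PhiB_jclass u i (mu : 'I_(r i)) :
  quot_Phi (u - jclass g mu) = quot_Phi u - g i mu.
Proof.
rewrite -(Phi_jvec g mu) -[in LHS](reprK u) /jclass.
have -> : \pi_(quot_lattice g)%qT (quot_repr u) -
    \pi_(quot_lattice g)%qT (jvec mu) =
  \pi_(quot_lattice g)%qT (quot_repr u - jvec mu) by rewrite !piE.
by rewrite quot_Phi_pi raddfB.
Qed.

Lemma quot_Phi_gen u : quot_Phi u \in gen_subgroup g.
Proof.
rewrite /quot_Phi /Phi; elim/big_ind: _ => [|x y Hx Hy|p _].
- exact: group1.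
- by rewrite -FinRing.zmodMgE groupM.
have gp : gen_family g p \in gen_subgroup g.
  by apply/mem_gen/imsetP; exists p.
(* According to the sign of the coefficient, the term is a power of a generator or the inverse of
   one, in multiplicative reading. *)
case: (quot_repr u p) => n;
  rewrite ?NegzE ?mulrNz -pmulrn -?FinRing.zmodXgE ?groupX //.
by rewrite -FinRing.zmodVgE groupV groupX.
Qed.

(** As G is finite, [h] is a product of generators without inverses; each generator lifts to its
    [jclass], and lifts add up. *)
Lemma quot_Phi_onto h : h \in gen_subgroup g -> exists u, quot_Phi u = h.
Proof.
move=> /gen_prodgP[n [c cP ->]]; elim/big_ind: _ => [|x y [u <-] [v <-]|i _].
- by exists (\pi_(quot_lattice g)%qT 0); rewrite quot_Phi_pi raddf0.
- exists (\pi_(quot_lattice g)%qT (quot_repr u + quot_repr v)).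
  by rewrite quot_Phi_pi raddfD FinRing.zmodMgE.
have /imsetP[[i' mu] _ ->] := cP i.
by exists (jclass g mu); rewrite quot_Phi_pi Phi_jvec.
Qed.

(* The element of G assigned to position u in the copy indexed by C. *)
Definition pos (C : coset_index (gen_subgroup g)) (u : quot_lattice g) : G :=
  repr (val C) + quot_Phi u.

(** A position differs from the representative of [C] by an element of the subgroup, so it
    determines its copy. *)
Lemma rcoset_pos C u : (gen_subgroup g :* pos C u)%g = val C.
Proof.
case: C => C CP; rewrite /pos /=; have /rcosetsP[x _ ->] := CP.
apply/rcoset_eqP; rewrite mem_rcoset FinRing.zmodVgE FinRing.zmodMgE.
rewrite addrAC -FinRing.zmodMgE groupM ?quot_Phi_gen //.
have := mem_repr_rcoset (gen_subgroup g) x.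
by rewrite mem_rcoset FinRing.zmodVgE.
Qed.

Lemma pos_inj C C' u u' : pos C u = pos C' u' -> C = C' /\ u = u'.
Proof.
move=> e; have eC : C = C'.
  by apply: val_inj; rewrite -(rcoset_pos C u) e rcoset_pos.
by split=> //; move: e; rewrite eC => /addrI /quot_Phi_inj.
Qed.

Lemma pos_onto h : exists C u, pos C u = h.
Proof.
have CP : (gen_subgroup g :* h)%g \in rcosets (gen_subgroup g) [set: G].
  by apply/rcosetsP; exists h; rewrite ?inE.
have : h - repr (gen_subgroup g :* h)%g \in gen_subgroup g.
  have := mem_repr_rcoset (gen_subgroup g) h.
  rewrite mem_rcoset FinRing.zmodVgE FinRing.zmodMgE -groupV.
  by rewrite FinRing.zmodVgE opprB.
case/quot_Phi_onto => u eu.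
exists (Sub (gen_subgroup g :* h)%g CP : coset_index (gen_subgroup g)), u.
by rewrite /pos /= eu addrC subrK.
Qed.

Lemma amc_elt_pos i C C' u u' :
    (forall mu, g i mu <> 0) -> injective (g i) ->
  (amc_elt g i (pos C u - pos C' u') != 0) =
  (C == C') && ((u' == u) || [exists mu : 'I_(r i), u' == u - jclass g mu]).
Proof.
move=> g0 ginj; rewrite amc_elt_neq0 // subr_eq0.
(* Subtracting a generator in G is a lattice step inside the same copy, so injectivity of [pos]
   yields both equalities. *)
have posB mu : (pos C u - pos C' u' == g i mu) =
    (C == C') && (u' == u - jclass g mu).
  rewrite subr_eq addrC -subr_eq /pos -addrA -quot_PhiB_jclass.
  apply/eqP/andP => [|[/eqP -> /eqP -> //]].
  by case/pos_inj => -> ->.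
apply/orP/andP => [[/eqP|/existsP[mu]]|[eC /orP[/eqP -> |/existsP[mu e]]]].
- by case/pos_inj => -> ->; rewrite !eqxx.
- rewrite posB => /andP[-> e]; split=> //.
  by apply/orP; right; apply/existsP; exists mu.
- by left; rewrite (eqP eC).
- by right; apply/existsP; exists mu; rewrite posB eC.
Qed.

Lemma mem_nbhd_minus i q u (v : site g) :
  (v \in nbhd_minus i q u) =
  (v.1 == q) && ((v.2 == u) || [exists mu : 'I_(r i), v.2 == u - jclass g mu]).
Proof.
case: v => I v /=; rewrite inE xpair_eqE andb_orr; congr orb.
apply/imageP/andP => [[mu _ [-> ->]]|[/eqP -> /existsP[mu /eqP ->]]];
  last by exists mu.
by rewrite eqxx; split=> //; apply/existsP; exists mu.
Qed.

(** The shift is moved to the qubit side, to match [amc_elt_pos] with check and qubit exchanged by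
    the transpose in H_Z. *)
Lemma mem_nbhd_plus i q u (v : site g) :
  (v \in nbhd_plus i q u) =
  (v.1 == q) && ((u == v.2) || [exists mu : 'I_(r i), u == v.2 - jclass g mu]).
Proof.
case: v => I v /=; rewrite inE xpair_eqE andb_orr [v == u]eq_sym; congr orb.
apply/imageP/andP => [[mu _ [-> ->]]|[/eqP -> /existsP[mu /eqP ->]]];
  last first.
  by exists mu => //; rewrite subrK.
by rewrite eqxx; split=> //; apply/existsP; exists mu; rewrite addrK.
Qed.

End QuotientLattice.

(** * Numbering the vertices by matrix indices *)

Lemma inj_onto_bij (T : choiceType) (T' : eqType) (f : T -> T') :
  injective f -> (forall y, exists x, f x = y) -> bijective f.
Proof.
move=> f_inj f_onto; have ex y : exists x, f x == y.
  by have [x <-] := f_onto y; exists x.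
exists (fun y => xchoose (ex y)) => [x|y]; last exact/eqP/(xchooseP (ex y)).
exact/f_inj/eqP/(xchooseP (ex (f x))).
Qed.

(** Counting: [rank] is injective on the k-subsets, of which there are exactly ['C(n, k)]. *)
Lemma rank_onto n k (a : 'I_('C(n, k))) :
  exists2 I : {set 'I_n}, #|I| = k & rank I = a.
Proof.
pose f (I : {I : {set 'I_n} | #|I| == k}) : 'I_('C(n, k)) :=
  Ordinal (rank_lt_card (eqP (valP I))).
have f_inj : injective f.
  move=> I J /(congr1 val) /= e; apply: val_inj; apply: rank_inj e.
  by rewrite (eqP (valP I)) (eqP (valP J)).
have [|f' _ f'K] := inj_card_bij f_inj.
  by rewrite card_sig card_ord -[n in 'C(n, _)]card_ord -card_draws cardsE.
exists (val (f' a)); first exact/eqP/(valP (f' a)).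
exact: (congr1 val (f'K a)).
Qed.

Section VertexIndex.
Variables (G : finZmodType) (D : nat) (r : 'I_D -> nat).
Variable g : forall i : 'I_D, 'I_(r i) -> G.

(** [mxtens_index] flattens the pair to block times [#|G|] plus offset, the form of index that
    [amc_mxE] expects. *)
Definition vertex_index k (Cv : coset_index (gen_subgroup g) * vertex g k) :
    'I_('C(D, k) * #|G|) :=
  mxtens_index (Ordinal (rank_lt_card (eqP (valP Cv.2))),
                enum_rank (pos Cv.1 (val Cv.2).2)).

Lemma vertex_index_bij k : bijective (@vertex_index k).
Proof.
apply: inj_onto_bij => [[C v] [C' v'] /(can_inj (@mxtens_indexK _ _)) [] eI|y].
  move=> /enum_rank_inj /pos_inj [-> ev]; congr pair; apply: val_inj.
  case: v v' eI ev => [[I u] /= cI] [[I' u'] /= cI'] eI /= ->; congr pair.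
  by apply: rank_inj eI; rewrite (eqP cI) (eqP cI').
case: (mxtens_indexP y) => a b; have [I cI eI] := rank_onto a.
have [C [u eu]] := pos_onto g (enum_val b).
have cI' : #|(I, u).1| == k by apply/eqP.
exists (C, Sub (I, u) cI'); apply: (congr1 (@mxtens_index _ _)); congr pair.
  exact: val_inj.
by rewrite /= eu enum_valK.
Qed.

End VertexIndex.

(** * Isomorphisms of Tanner graphs *)

Lemma AMC_vertex_index (G : finZmodType) n k (r : 'I_n.+2 -> nat)
    (g : forall i : 'I_n.+2, 'I_(r i) -> G) (a : 'I_n.+2 -> group_alg G)
    (s : coset_index (gen_subgroup g) * vertex g k)
    (q : coset_index (gen_subgroup g) * vertex g k.+1) :
  (AMC a k.+1 (vertex_index s) (vertex_index q) != 0) =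
  [exists m in ~: (val s.2).1, ((val q.2).1 == m |: (val s.2).1) &&
     (a m (pos s.1 (val s.2).2 - pos q.1 (val q.2).2) != 0)].
Proof.
rewrite (@amc_mxE _ _ _ _ (val s.2).1 (val q.2).1
  (enum_rank (pos s.1 (val s.2).2)) (enum_rank (pos q.1 (val q.2).2))) //.
- rewrite boundary_entry_neq0; apply: eq_existsb => m.
  by rewrite rhoE !enum_rankK.
- exact/eqP/(valP s.2).
- exact/eqP/(valP q.2).
Qed.

(** Serves both cases of the theorem: for H = G there is just one coset, hence one copy. *)
Lemma tanner_disjoint_copies (G : finZmodType) n k (r : 'I_n.+2 -> nat)
    (g : forall i : 'I_n.+2, 'I_(r i) -> G)
    (g0 : forall i mu, g i mu <> 0) (ginj : forall i, injective (g i)) :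
  perm_isomorphic
    (disjoint_copies (coset_index (gen_subgroup g)) (lattice_tanner g k.+1))
    (tanner_of_css (AMC (amc_elt g) k.+1) (AMC (amc_elt g) k.+2)^T).
Proof.
exists (@vertex_index _ _ _ g k.+1), (@vertex_index _ _ _ g k),
  (@vertex_index _ _ _ g k.+2); split; try exact: vertex_index_bij.
- move=> s q; rewrite [LHS]AMC_vertex_index /=.
  case: s q => [C [[K u] cK]] [C' [[I v] cI]] /=.
  apply/exists_inP/andP => [[m mK]|[eC /exists_inP[m mK]]].
    rewrite amc_elt_pos // => /and3P[eI eC uv]; split=> //.
    by apply/exists_inP; exists m => //; rewrite mem_nbhd_minus /= eI.
  rewrite mem_nbhd_minus /= => /andP[eI uv].
  by exists m; rewrite ?eI ?amc_elt_pos ?eC.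
(* After transposition the qubit labels the row and the check the column, so [M = m |: I] must be
   turned into [I = M :\ m]. *)
- move=> s q; rewrite /= mxE AMC_vertex_index.
  case: s q => [C [[M u] cM]] [C' [[I v] cI]] /=.
  apply/exists_inP/andP => [[m mI]|[eC /exists_inP[m mM]]].
    rewrite amc_elt_pos // inE in mI * => /and3P[/eqP eM eC uv].
    split; first by rewrite eq_sym.
    apply/exists_inP; exists m; first by rewrite eM setU11.
    by rewrite mem_nbhd_plus /= eM setU1K // eqxx.
  rewrite mem_nbhd_plus /= => /andP[/eqP eI uv].
  exists m; first by rewrite eI !inE eqxx.
  by rewrite eI setD1K // eqxx amc_elt_pos // eq_sym eC.
Qed.

Lemma perm_isomorphic_trans T1 T2 T3 :
  perm_isomorphic T1 T2 -> perm_isomorphic T2 T3 -> perm_isomorphic T1 T3.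
Proof.
case=> fq [fx [fz [bq bx bz ax az]]] [fq' [fx' [fz' [bq' bx' bz' ax' az']]]].
exists (fq' \o fq), (fx' \o fx), (fz' \o fz).
split=> [| | |s q|s q] /=; rewrite ?ax' ?az' //; exact: bij_comp.
Qed.

Lemma disjoint_copies1 (C : eqType) T (c0 : C) :
  (forall c, c = c0) -> perm_isomorphic T (disjoint_copies C T).
Proof.
move=> C1; have pair_bij (S : Type) : bijective (fun x : S => (c0, x)).
  by exists snd => // -[c x]; rewrite (C1 c).
exists (pair c0), (pair c0), (pair c0).
by split; try exact: pair_bij; move=> s q; rewrite /= eqxx.
Qed.

Theorem proposition3 (G : finZmodType) (D j : nat) (r : 'I_D -> nat)
    (g : forall i : 'I_D, 'I_(r i) -> G)
    (hD : (2 <= D)%N) (hj1 : (1 <= j)%N) (hjD : (j < D)%N)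
    (hg0 : forall (i : 'I_D) (mu : 'I_(r i)), g i mu <> 0)
    (hginj : forall i : 'I_D, injective (g i)) :
  let HX := AMC (amc_elt g) j in
  let HZ := (AMC (amc_elt g) j.+1)^T in
  let T := lattice_tanner g j in
  let H := gen_subgroup g in
  (H = [set: G] :> {set G} -> perm_isomorphic T (tanner_of_css HX HZ)) /\
  (H \proper [set: G] ->
     perm_isomorphic (disjoint_copies (coset_index H) T) (tanner_of_css HX HZ)).
Proof.
case: D j r g hD hj1 hjD hg0 hginj => [|[|n]] // [|k] // r g _ _ _ hg0 hginj.
have copies := tanner_disjoint_copies k hg0 hginj.
split=> [HG|_]; last exact: copies.
apply: perm_isomorphic_trans copies.
(* The subgroup itself, as the coset of the identity, is the single index when H = G. *)
have HP : (gen_subgroup g : {set G}) \in rcosets (gen_subgroup g) [set: G].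
  by apply/rcosetsP; exists 1%g; rewrite ?inE ?mulg1.
apply: (@disjoint_copies1 _ _ (Sub (gen_subgroup g : {set G}) HP)).
case=> C CP; apply: val_inj; rewrite /=; have /rcosetsP[x _ ->] := CP.
by apply: rcoset_id; rewrite HG inE.
Qed.
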